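(* Let $\mathsf V=(\mathsf V,\otimes,\mathsf k)$ be a quantale and $X$ a set. (1) If $(X,c)$ is a $\mathsf V$-closure space, then with $c^vA:=\{x\in X\mid (cA)(x)\ge v\}$ ($v\in\mathsf V$, $A\subseteq X$) one obtains a family of maps $(c^v:\mathsf PX\to\mathsf PX)_{v\in\mathsf V}$ satisfying, for all $A,B\subseteq X$ and $u,v,u_i\in\mathsf V$ ($i\in I$, $I$ any index set): (C0) if $B\subseteq A$, then $c^vB\subseteq c^vA$; (C1) if $v\le\bigvee_{i\in I}u_i$, then $\bigcap_{i\in I}c^{u_i}A\subseteq c^vA$; (C2) $A\subseteq c^{\mathsf k}A$; (C3) $c^uc^vA\subseteq c^{v\otimes u}A$. (2) Conversely, for any family of maps $(c^v:\mathsf PX\to\mathsf PX)_{v\in\mathsf V}$ satisfying (C0)--(C3), putting $(cA)(x):=\bigvee\{v\in\mathsf V\mid x\in c^vA\}$ ($A\subseteq X$, $x\in X$) makes $(X,c)$ a $\mathsf V$-closure space. (3) The correspondences of (1) and (2) are inverse to each other. Under this bijection, a map $f:X\to Y$ between $\mathsf V$-closure spaces $(X,c)$ and $(Y,d)$ is contractive if and only if $f(c^vA)\subseteq d^v(f(A))$ for all $A\subseteq X$, $v\in\mathsf V$.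
   Context: A quantale $\mathsf V=(\mathsf V,\otimes,\mathsf k)$ is a complete lattice with a (not necessarily commutative) monoid structure whose operation $\otimes$ preserves arbitrary suprema in each variable; no relation between $\mathsf k$ and $\bot,\top$ is assumed. $\mathsf PX$ is the power set of $X$; an intersection of subsets of $X$ over an empty index set is $X$. A $\mathsf V$-closure space $(X,c)$ is a set $X$ with a map $c:\mathsf PX\to\mathsf V^X$ such that (R') $\mathsf k\le c(\{x\})(x)$ for all $x\in X$; (T') $\big(\bigwedge_{y\in B}\bigvee_{A\in\mathcal A}(cA)(y)\big)\otimes (cB)(z)\le c(\bigcup\mathcal A)(z)$ for all $\mathcal A\subseteq\mathsf PX$, $B\subseteq X$, $z\in X$. A map $f:(X,c)\to(Y,d)$ of $\mathsf V$-closure spaces is contractive if $(cA)(x)\le (d f(A))(f(x))$ for all $A\subseteq X$, $x\in X$. *)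

(* Defs.v *)
From HB Require Import structures.
From mathcomp Require Import all_boot all_order.
From mathcomp Require Import boolp classical_sets.

Set Implicit Arguments.
Unset Strict Implicit.
Unset Printing Implicit Defensive.

Import Order.Theory.
Local Open Scope classical_set_scope.
Local Open Scope group_scope.
Local Open Scope order_scope.

(* `supremums A` and `infimums A` are the sets of least upper and greatest
   lower bounds of A, so bigsup set0 and biginf set0 are bottom and top. *)
HB.mixin Record isCompleteLattice (disp : Order.disp_t) V
    of Order.POrder disp V := {
  bigsup : set V -> V;
  biginf : set V -> V;
  bigsupP : forall A : set V, supremums A (bigsup A);
  biginfP : forall A : set V, infimums A (biginf A)
}.

#[short(type="completeLatticeType")]
HB.structure Definition CompleteLattice (disp : Order.disp_t) :=
  { V of Order.POrder disp V & isCompleteLattice disp V }.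

(* The tensor is the (multiplicatively written) product of the monoid, and the
   neutral element k is 1. *)
HB.mixin Record isQuantale (disp : Order.disp_t) V
    of CompleteLattice disp V & Monoid V := {
  mul_bigsupl : forall (A : set V) (b : V),
    bigsup A * b = bigsup [set a * b | a in A];
  mul_bigsupr : forall (a : V) (B : set V),
    a * bigsup B = bigsup [set a * b | b in B]
}.

#[short(type="quantaleType")]
HB.structure Definition Quantale (disp : Order.disp_t) :=
  { V of CompleteLattice disp V & Monoid V & isQuantale disp V }.

Section VClosure.
Variables (disp : Order.disp_t) (V : quantaleType disp).

Record is_Vclosure (X : Type) (c : set X -> X -> V) : Prop := {
  Vclosure_refl : forall x : X, 1 <= c [set x] x;
  Vclosure_trans : forall (AA : set (set X)) (B : set X) (z : X),
    biginf [set bigsup [set c A y | A in AA] | y in B] * c B z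
      <= c (\bigcup_(A in AA) A) z
}.

Definition contractive (X Y : Type) (c : set X -> X -> V)
    (d : set Y -> Y -> V) (f : X -> Y) : Prop :=
  forall (A : set X) (x : X), c A x <= d (f @` A) (f x).

(* c^v is written `levels c v`. *)
Definition levels (X : Type) (c : set X -> X -> V) : V -> set X -> set X :=
  fun v A => [set x | v <= c A x].

Record is_level_family (X : Type) (c : V -> set X -> set X) : Prop := {
  levelC0 : forall (v : V) (A B : set X), B `<=` A -> c v B `<=` c v A;
  levelC1 : forall (I : Type) (u : I -> V) (v : V) (A : set X),
    v <= bigsup (range u) -> \bigcap_(i in [set: I]) c (u i) A `<=` c v A;
  levelC2 : forall A : set X, A `<=` c 1 A;
  levelC3 : forall (u v : V) (A : set X), c u (c v A) `<=` c (v * u) A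
}.

Definition of_levels (X : Type) (c : V -> set X -> set X) : set X -> X -> V :=
  fun A x => bigsup [set v | c v A x].

End VClosure.

(* Main.v *)
(** Everything rests on [w <= of_levels c A x] being equivalent to [c w A x]:
    condition (C1), applied to the family of all [v] with [x \in c^v A], turns
    the supremum back into membership.  In (1), monotonicity of a V-closure is
    transitivity for the family of singletons of the larger set, whose union is
    that set and whose infimum is above [k] by reflexivity. *)
Require Import Defs.
From HB Require Import structures.
From mathcomp Require Import all_boot all_order.
From mathcomp Require Import boolp classical_sets.

Set Implicit Arguments.
Unset Strict Implicit.
Unset Printing Implicit Defensive.

Import Order.Theory.
Local Open Scope classical_set_scope.
Local Open Scope group_scope.
Local Open Scope order_scope.

Section CompleteLattice.
Variables (disp : Order.disp_t) (V : completeLatticeType disp).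
Implicit Types (A : set V) (x y : V).

Lemma bigsup_ge A x : A x -> x <= bigsup A.
Proof. by move: x; case: (bigsupP A). Qed.

Lemma bigsup_le A y : (forall x, A x -> x <= y) -> bigsup A <= y.
Proof. by case: (bigsupP A) => _ + Ay; apply. Qed.

Lemma biginf_le A x : A x -> biginf A <= x.
Proof. by move: x; case: (biginfP A). Qed.

Lemma biginf_ge A y : (forall x, A x -> y <= x) -> y <= biginf A.
Proof. by case: (biginfP A) => _ + Ay; apply. Qed.

(** Writing an element as the supremum of its down-set lets preservation of suprema by the tensor
    yield monotonicity in each variable. *)
Lemma bigsup_down x : bigsup [set y | y <= x] = x.
Proof. by apply/le_anti; rewrite bigsup_ge //= bigsup_le. Qed.

End CompleteLattice.

Section Quantale.
Variables (disp : Order.disp_t) (V : quantaleType disp).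
Implicit Types (u v w : V).

Lemma quantale_leM2r w u v : u <= v -> u * w <= v * w.
Proof.
move=> uv; rewrite -[v]bigsup_down mul_bigsupl.
by apply: bigsup_ge; exists u.
Qed.

Lemma quantale_leM2l w u v : u <= v -> w * u <= w * v.
Proof.
move=> uv; rewrite -[v]bigsup_down mul_bigsupr.
by apply: bigsup_ge; exists u.
Qed.

Lemma quantale_leM u u' v v' : u <= u' -> v <= v' -> u * v <= u' * v'.
Proof.
by move=> uu' /(quantale_leM2l u)/le_trans; apply; exact: quantale_leM2r.
Qed.

End Quantale.

Section Levels.
Variables (disp : Order.disp_t) (V : quantaleType disp) (X : Type).

Lemma Vclosure_mono (c : set X -> X -> V) (A B : set X) (z : X) :
  is_Vclosure c -> B `<=` A -> c B z <= c A z.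
Proof.
move=> cV BA.
have := Vclosure_trans cV [set [set y] | y in A] B z.
rewrite bigcup_image bigcup_imset1 image_id; apply: le_trans.
rewrite -[leLHS]mul1g; apply: quantale_leM2r; apply: biginf_ge => _ [y By <-].
apply: le_trans (Vclosure_refl cV y) (bigsup_ge _).
by exists [set y] => //; exists y => //; exact: BA.
Qed.

Lemma levels_is_level_family (c : set X -> X -> V) :
  is_Vclosure c -> is_level_family (levels c).
Proof.
move=> cV; split.
- by move=> v A B BA x /= /le_trans; apply; exact: Vclosure_mono.
- move=> I u v A vu x ux; apply: le_trans vu _; apply: bigsup_le => _ [i _ <-].
  exact: ux.
- move=> A x Ax; apply: le_trans (Vclosure_refl cV x) _.
  by apply: Vclosure_mono => // _ ->.
- move=> u v A x /= ux.
  (* Transitivity is used for the one-member family [[set A]] and [B := levels c v A]: every [y] in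
     [B] has [v <= c A y], so the infimum is at least [v]. *)
  have := Vclosure_trans cV [set A] (levels c v A) x; rewrite bigcup_set1.
  apply: le_trans; apply: quantale_leM ux.
  by apply: biginf_ge => _ [y vy <-]; apply: le_trans vy (bigsup_ge _); exists A.
Qed.

Lemma le_of_levels (c : V -> set X -> set X) (w : V) (A : set X) (x : X) :
  is_level_family c -> w <= of_levels c A x <-> c w A x.
Proof.
move=> cL; split=> [wc|]; last exact: bigsup_ge.
(* The index type consists of exactly the [v] with [c v A x], so [x] lies in the intersection by the
   second component of each index. *)
apply: (levelC1 cL (u := fun v : {v | c v A x} => sval v)); last by case.
apply: le_trans wc _; apply: bigsup_le => v cv.
by apply: bigsup_ge; exists (exist _ v cv).
Qed.

(** For transitivity, the infimum [w] is itself used as a level: [B] lies in the [w]-closure of the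
    union, and composing levels by (C3) turns this into the tensor with [w]. *)
Lemma of_levels_is_Vclosure (c : V -> set X -> set X) :
  is_level_family c -> is_Vclosure (of_levels c).
Proof.
move=> cL; split=> [x|AA B z]; first by apply/le_of_levels => //; exact: levelC2.
set w := biginf _; set U := \bigcup_(A in AA) A.
have Bw : B `<=` c w U.
  move=> y By; apply/le_of_levels => //.
  apply: (@le_trans _ _ (bigsup [set of_levels c A y | A in AA])).
    by apply: biginf_le; exists y.
  apply: bigsup_le => _ [A AAA <-]; apply: bigsup_le => v /= cv.
  apply/le_of_levels => //; apply: levelC0 cv => //.
  exact: bigcup_sup.
(* As the tensor preserves the supremum defining [of_levels c B z], it is enough to treat each [v]
   with [c v B z]; then [z] lies in [c v (c w U)] by (C0), hence in [c (w * v) U]. *)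
rewrite mul_bigsupr; apply: bigsup_le => _ [v /= cv <-].
apply/le_of_levels => //; apply: (levelC3 cL).
exact: levelC0 cv.
Qed.

(** The supremum on the left is that of the down-set of [c A x]. *)
Lemma levelsK (c : set X -> X -> V) : of_levels (levels c) = c.
Proof. by apply/funext => A; apply/funext => x; exact: bigsup_down. Qed.

Lemma of_levelsK (c : V -> set X -> set X) :
  is_level_family c -> levels (of_levels c) = c.
Proof.
move=> cL; apply/funext => v; apply/funext => A; apply/funext => x.
by apply/propext; exact: le_of_levels.
Qed.

Lemma contractive_levels (Y : Type) (c : set X -> X -> V) (d : set Y -> Y -> V)
    (f : X -> Y) :
  contractive c d f <->
  forall (A : set X) (v : V), f @` levels c v A `<=` levels d v (f @` A).
Proof.
split=> [fc A v _ [x vx <-]|fl A x]; first exact: le_trans vx (fc A x).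
(* The level [c A x] is the largest one whose closure of [A] contains [x], so the inclusion at this
   level is the sharpest bound. *)
by apply: (fl A (c A x)); exists x => //=; exact: lexx.
Qed.

End Levels.

Theorem proposition2p6 (disp : Order.disp_t) (V : quantaleType disp)
    (X : Type) :
  (* (1) *)
  (forall c : set X -> X -> V, is_Vclosure c -> is_level_family (levels c)) /\
  (* (2) *)
  (forall c : V -> set X -> set X,
     is_level_family c -> is_Vclosure (of_levels c)) /\
  (* (3) *)
  ((forall c : set X -> X -> V, is_Vclosure c -> of_levels (levels c) = c) /\
   (forall c : V -> set X -> set X,
      is_level_family c -> levels (of_levels c) = c) /\
   (forall (Y : Type) (c : set X -> X -> V) (d : set Y -> Y -> V) (f : X -> Y),
      is_Vclosure c -> is_Vclosure d ->
      (contractive c d f <->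
       forall (A : set X) (v : V),
         f @` (levels c v A) `<=` levels d v (f @` A)))).
Proof.
split; first exact: levels_is_level_family.
split; first exact: of_levels_is_Vclosure.
split; first by move=> c _; exact: levelsK.
split; first exact: of_levelsK.
by move=> Y c d f _ _; exact: contractive_levels.
Qed.
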